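(* Let $g,\tilde g$ be positive integers, let $\mathcal U\subseteq M(\mathbb C)^g$ and $\mathcal V\subseteq M(\mathbb C)^{\tilde g}$ be non-commutative domains, both containing $0$, and let $f:\mathcal U\to\mathcal V$ be a free map. (1) If $f$ is proper, then $f$ is one-to-one (i.e. each $f[n]$ is injective) and $f^{-1}:f(\mathcal U)\to\mathcal U$, $f^{-1}=(f[n]^{-1})_n$ with $f[n]^{-1}:f[n](\mathcal U(n))\to\mathcal U(n)$, is a free map. (2) If, for each $n$ and each $Z\in M_n(\mathbb C)^{\tilde g}$, the set $f[n]^{-1}(\{Z\})$ has compact closure in $\mathcal U(n)$, then $f$ is one-to-one and $f^{-1}:f(\mathcal U)\to\mathcal U$ is a free map. (3) If $g=\tilde g$ and $f:\mathcal U\to\mathcal V$ is proper and continuous, then $f$ is bianalytic: for every $n$, $f[n]$ is a bijection of $\mathcal U(n)$ onto $\mathcal V(n)$, and both $f$ and $f^{-1}:\mathcal V\to\mathcal U$ are proper analytic free maps.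
   Context: For $n\in\mathbb N$, $M_n(\mathbb C)^g$ denotes the set of $g$-tuples $X=(X_1,\dots,X_g)$ of $n\times n$ complex matrices. For $X\in M_n(\mathbb C)^g$, $Y\in M_m(\mathbb C)^g$, an $n\times m$ matrix $\Gamma$ and a unitary $U$, write $X\Gamma=(X_1\Gamma,\dots,X_g\Gamma)$, $\Gamma Y=(\Gamma Y_1,\dots,\Gamma Y_g)$, $U^*XU=(U^*X_1U,\dots,U^*X_gU)$ and $X\oplus Y=(X_1\oplus Y_1,\dots,X_g\oplus Y_g)$ (block diagonal). A non-commutative set $\mathcal U\subseteq M(\mathbb C)^g$ is a sequence $(\mathcal U(n))_{n\in\mathbb N}$ with $\mathcal U(n)\subseteq M_n(\mathbb C)^g$ such that $U^*XU\in\mathcal U(n)$ whenever $X\in\mathcal U(n)$ and $U$ is an $n\times n$ unitary, and $X\oplus Y\in\mathcal U(n+m)$ whenever $X\in\mathcal U(n)$, $Y\in\mathcal U(m)$. It is a non-commutative domain if each $\mathcal U(n)$ is open and connected; it contains $0$ if $0\in\mathcal U(n)$ for all $n$. A free map $f:\mathcal U\to M(\mathbb C)^{\tilde g}$ is a sequence of functions $f[n]:\mathcal U(n)\to M_n(\mathbb C)^{\tilde g}$ that respects intertwining maps: whenever $X\in\mathcal U(n)$, $Y\in\mathcal U(m)$, $\Gamma\in\mathbb C^{n\times m}$ and $X\Gamma=\Gamma Y$, then $f[n](X)\Gamma=\Gamma f[m](Y)$; one writes $f(X)$ for $f[n](X)$. For a non-commutative set $\mathcal V\subseteq M(\mathbb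 C)^{\tilde g}$, $f:\mathcal U\to\mathcal V$ means $f[n](\mathcal U(n))\subseteq\mathcal V(n)$ for all $n$, and $f(\mathcal U)=(f[n](\mathcal U(n)))_n$. $f$ is continuous (resp. analytic) if each $f[n]$ is continuous (resp. holomorphic); an analytic free map is a free map on a non-commutative domain with each $f[n]$ analytic. $f:\mathcal U\to\mathcal V$ is proper if each $f[n]:\mathcal U(n)\to\mathcal V(n)$ is proper, i.e. preimages of compact subsets of $\mathcal V(n)$ are compact. *)

(* Defs.v *)
(* Complex numbers: C := R[i] (mathcomp-real-closed `complex`) for R : realType,
   which is a numClosedFieldType; matrices over it carry the library's
   standard (entrywise max-norm) normed C-module structure. *)
From HB Require Import structures.
From mathcomp Require Import all_boot all_order all_algebra.
From mathcomp Require Import all_classical all_reals all_analysis.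
From mathcomp Require Import complex.
Import numFieldTopology.Exports numFieldNormedType.Exports.

Set Implicit Arguments.
Unset Strict Implicit.
Unset Printing Implicit Defensive.

Import Order.TTheory GRing.Theory Num.Theory.
Local Open Scope ring_scope.
Local Open Scope classical_set_scope.

(* A g-tuple X = (X_1,...,X_g) of n x n complex matrices is stored as the
   g x (n*n) matrix whose i-th row is mxvec X_i.  This identifies
   M_n(C)^g with C^(g*n*n); its topology (and C-linear normed structure,
   used for holomorphy) is the library's one on 'M[C]_(g, n*n), i.e. the
   standard Euclidean topology. *)
(* Standard metric topology on C = R[i] induced by the complex modulus
   (the library declares it generically only for a variable numFieldType). *)
HB.instance Definition _ (R : rcfType) := PseudoPointedMetric.copy R[i] (R[i])^o.

Notation ncmx R n g := 'M[R[i]]_(g, n * n).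

Section NC.
Variable R : realType.
Local Notation C := R[i].

Definition comp n g (X : ncmx R n g) (i : 'I_g) : 'M[C]_n := vec_mx (row i X).

Definition mxadj n m (W : 'M[C]_(n, m)) : 'M[C]_(m, n) := (map_mx Num.conj W)^T.

Definition unitarymx n (W : 'M[C]_n) : Prop := mxadj W *m W = 1%:M.

Definition uconj n g (W : 'M[C]_n) (X : ncmx R n g) : ncmx R n g :=
  \matrix_(i < g) mxvec (mxadj W *m comp X i *m W).

Definition dsum n m g (X : ncmx R n g) (Y : ncmx R m g) : ncmx R (n + m) g :=
  \matrix_(i < g) mxvec (block_mx (comp X i) 0 0 (comp Y i)).

Definition intertwines n m g (X : ncmx R n g) (Gam : 'M[C]_(n, m))
  (Y : ncmx R m g) : Prop :=
  forall i : 'I_g, comp X i *m Gam = Gam *m comp Y i.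

(* Levels n range over positive integers; the value of a family at n = 0
   is irrelevant and never constrained. *)
Definition nc_set g (U : forall n, set (ncmx R n g)) : Prop :=
  (forall n (W : 'M[C]_n) (X : ncmx R n g),
      (0 < n)%N -> U n X -> unitarymx W -> U n (uconj W X)) /\
  (forall n m (X : ncmx R n g) (Y : ncmx R m g),
      (0 < n)%N -> (0 < m)%N -> U n X -> U m Y -> U (n + m)%N (dsum X Y)).

Definition nc_domain g (U : forall n, set (ncmx R n g)) : Prop :=
  nc_set U /\ (forall n, (0 < n)%N -> open (U n) /\ connected (U n)).

Definition contains0 g (U : forall n, set (ncmx R n g)) : Prop :=
  forall n, (0 < n)%N -> U n 0.

Definition free_map g gt (U : forall n, set (ncmx R n g))
  (f : forall n, ncmx R n g -> ncmx R n gt) : Prop :=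
  forall n m (X : ncmx R n g) (Y : ncmx R m g) (Gam : 'M[C]_(n, m)),
    (0 < n)%N -> (0 < m)%N -> U n X -> U m Y ->
    intertwines X Gam Y -> intertwines (f n X) Gam (f m Y).

Definition maps_into g gt (U : forall n, set (ncmx R n g))
  (V : forall n, set (ncmx R n gt)) (f : forall n, ncmx R n g -> ncmx R n gt) :=
  forall n, (0 < n)%N -> forall X, U n X -> V n (f n X).

Definition image_nc g gt (U : forall n, set (ncmx R n g))
  (f : forall n, ncmx R n g -> ncmx R n gt) : forall n, set (ncmx R n gt) :=
  fun n => f n @` U n.

Definition proper_map g gt (U : forall n, set (ncmx R n g))
  (V : forall n, set (ncmx R n gt)) (f : forall n, ncmx R n g -> ncmx R n gt) :=
  forall n, (0 < n)%N -> forall K : set (ncmx R n gt),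
    K `<=` V n -> compact K -> compact (U n `&` f n @^-1` K).

Definition continuous_map g gt (U : forall n, set (ncmx R n g))
  (f : forall n, ncmx R n g -> ncmx R n gt) :=
  forall n, (0 < n)%N -> forall X, U n X -> {for X, continuous (f n)}.

(* each f[n] is holomorphic on (the open set) U(n): complex Frechet
   differentiable at every point (differentiable w.r.t. the C-normed
   structure of the matrix spaces). *)
Definition analytic_map g gt (U : forall n, set (ncmx R n g))
  (f : forall n, ncmx R n g -> ncmx R n gt) :=
  forall n, (0 < n)%N -> forall X, U n X -> differentiable (f n) X.

Definition one_to_one g gt (U : forall n, set (ncmx R n g))
  (f : forall n, ncmx R n g -> ncmx R n gt) :=
  forall n, (0 < n)%N -> forall X Y, U n X -> U n Y -> f n X = f n Y -> X = Y.

End NC.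

(* Main.v *)
(** For [H = X G - G Y] the block triangular tuple [utri X H Y] = [[X, H], [0, Y]]
    is similar to [X (+) Y], and a free map sends it to
    [utri (f X) (f X G - G f Y) (f Y)].  If [G] intertwines [f X] and [f Y], then
    all the tuples [utri X (t H) Y] in the domain lie in one fibre of [f];
    compactness of that fibre keeps the whole real line [t] in the domain and
    bounds [t H], so [H = 0] and [G] intertwines [X] and [Y].  With [G = 1] this
    is injectivity, and in general it says that the inverse is free.

    In the third part, [f (utri Y (s H) X)] has an upper right corner [s L_Y(H)]
    with [L_Y] linear in [H], continuous in [Y], and [f Y - f X = L_Y(Y - X)].
    Hence [f] is complex differentiable at [X] with derivative [L_X], which is
    injective because [f] is injective at level [2n], and so bijective.  At a
    minimum of [|f Y - W|] over a compact preimage the invertible derivative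
    forces [f Y = W]; thus the image is open and closed in the connected set
    [V n].  The inverse is continuous by properness, and free by the first part,
    so the same argument makes it analytic. *)
Require Import Defs.
From HB Require Import structures.
From mathcomp Require Import all_boot all_order all_algebra.
From mathcomp Require Import all_classical all_reals all_analysis.
From mathcomp Require Import complex.
From mathcomp Require Import lra.
Import numFieldTopology.Exports numFieldNormedType.Exports.
Import Order.TTheory GRing.Theory Num.Theory.
Import Defs.

Set Implicit Arguments.
Unset Strict Implicit.
Unset Printing Implicit Defensive.

Local Open Scope ring_scope.
Local Open Scope classical_set_scope.

(** * Tuples of rectangular matrices and block triangular tuples *)

Section Tuples.
Context {R : realType}.
Local Notation C := R[i].

(* Tuples of rectangular matrices, stored as in [ncmx]; [rcomp X] is
   convertible to [comp X] when the matrices are square. *)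
Definition rcomp {g n m : nat} (H : 'M[C]_(g, n * m)) (i : 'I_g) : 'M[C]_(n, m) :=
  vec_mx (row i H).

Definition mktuple {g n m : nat} (A : 'I_g -> 'M[C]_(n, m)) : 'M[C]_(g, n * m) :=
  \matrix_(i < g) mxvec (A i).

Lemma rcompK {g n m : nat} (A : 'I_g -> 'M[C]_(n, m)) i : rcomp (mktuple A) i = A i.
Proof. by rewrite /rcomp /mktuple rowK mxvecK. Qed.

Lemma rcomp_inj {g n m : nat} (H K : 'M[C]_(g, n * m)) :
  (forall i, rcomp H i = rcomp K i) -> H = K.
Proof. by move=> HK; apply/row_matrixP => i; exact: (can_inj (@vec_mxK _ _ _) (HK i)). Qed.

Lemma rcompZD {g n m : nat} (a : C) (H K : 'M[C]_(g, n * m)) i :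
  rcomp (a *: H + K) i = a *: rcomp H i + rcomp K i.
Proof. by rewrite /rcomp linearP /= linearP. Qed.

Lemma rcompZ {g n m : nat} (a : C) (H : 'M[C]_(g, n * m)) i :
  rcomp (a *: H) i = a *: rcomp H i.
Proof. by rewrite /rcomp linearZ /= linearZ. Qed.

Lemma rcompD {g n m : nat} (H K : 'M[C]_(g, n * m)) i :
  rcomp (H + K) i = rcomp H i + rcomp K i.
Proof. by rewrite -[H]scale1r rcompZD !scale1r. Qed.

Lemma rcompB {g n m : nat} (H K : 'M[C]_(g, n * m)) i :
  rcomp (H - K) i = rcomp H i - rcomp K i.
Proof. by rewrite addrC -scaleN1r rcompZD scaleN1r addrC. Qed.

Lemma rcomp0 {g n m : nat} i : rcomp (0 : 'M[C]_(g, n * m)) i = 0.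
Proof. by rewrite /rcomp linear0 linear0. Qed.

Definition utri {g n m : nat} (X : ncmx R n g) (H : 'M[C]_(g, n * m)) (Y : ncmx R m g)
  : ncmx R (n + m) g :=
  mktuple (fun i => block_mx (comp X i) (rcomp H i) 0 (comp Y i)).

Definition urtuple {g n m : nat} (Z : ncmx R (n + m) g) : 'M[C]_(g, n * m) :=
  mktuple (fun i => ursubmx (comp Z i)).

Lemma comp_utri {g n m : nat} (X : ncmx R n g) (H : 'M[C]_(g, n * m)) (Y : ncmx R m g) i :
  comp (utri X H Y) i = block_mx (comp X i) (rcomp H i) 0 (comp Y i).
Proof. exact: rcompK. Qed.

Lemma rcomp_urtuple {g n m : nat} (Z : ncmx R (n + m) g) i :
  rcomp (urtuple Z) i = ursubmx (comp Z i).
Proof. exact: rcompK. Qed.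

Lemma urtuple_utri {g n m : nat} (X : ncmx R n g) (H : 'M[C]_(g, n * m)) (Y : ncmx R m g) :
  urtuple (utri X H Y) = H.
Proof. by apply: rcomp_inj => i; rewrite rcomp_urtuple comp_utri block_mxKur. Qed.

Lemma dsum_utri {g n m : nat} (X : ncmx R n g) (Y : ncmx R m g) : dsum X Y = utri X 0 Y.
Proof. by apply: rcomp_inj => i; rewrite -[RHS]/(comp _ i) comp_utri rcomp0; exact: rcompK. Qed.

Lemma utriP {g n m : nat} (a : C) (X X' : ncmx R n g) (H H' : 'M[C]_(g, n * m))
    (Y Y' : ncmx R m g) :
  utri (a *: X + X') (a *: H + H') (a *: Y + Y') = a *: utri X H Y + utri X' H' Y'.
Proof.
apply: rcomp_inj => i; rewrite rcompZD !rcompK /comp.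
rewrite -!/(rcomp _ i) !rcompZD -/(rcomp X i) -/(rcomp X' i) -/(rcomp Y i) -/(rcomp Y' i).
by rewrite scale_block_mx add_block_mx scaler0 addr0.
Qed.

Lemma urtupleP {g n m : nat} (a : C) (Z Z' : ncmx R (n + m) g) :
  urtuple (a *: Z + Z') = a *: urtuple Z + urtuple Z'.
Proof.
apply: rcomp_inj => i; rewrite rcompZD !rcomp_urtuple /comp -!/(rcomp _ i) rcompZD.
by apply/matrixP => j k; rewrite !mxE.
Qed.

End Tuples.

(** * Values of free maps on block triangular tuples *)

Section FreeMaps.
Context {R : realType} {g gt : nat} {U : forall n, set (ncmx R n g)}
  {f : forall n, ncmx R n g -> ncmx R n gt}.
Local Notation C := R[i].
Hypothesis free : free_map U f.

Definition offdiag {n m : nat} (X : ncmx R n g) (H : 'M[C]_(g, n * m)) (Y : ncmx R m g) :=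
  urtuple (f (utri X H Y)).

(** The block column [(1; 0)] intertwines the triangular tuple with [X], and the block row [(0, 1)]
    intertwines [Y] with it. Freeness thus fixes the first block column and the last block row of
    the value, leaving only the corner. *)
Lemma free_utri {n m : nat} (X : ncmx R n g) (H : 'M[C]_(g, n * m)) (Y : ncmx R m g) :
  (0 < n)%N -> (0 < m)%N -> U X -> U Y -> U (utri X H Y) ->
  f (utri X H Y) = utri (f X) (offdiag X H Y) (f Y).
Proof.
move=> n0 m0 UX UY UZ; have nm0 : (0 < n + m)%N by rewrite addn_gt0 n0.
have L : intertwines (utri X H Y) (col_mx 1%:M 0) X.
  move=> i; rewrite comp_utri mul_block_col mul_col_mx.
  by rewrite !mulmx1 !mulmx0 !mul1mx !mul0mx !addr0.
have T : intertwines Y (row_mx 0 1%:M) (utri X H Y).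
  move=> i; rewrite comp_utri mul_row_block mul_mx_row.
  by rewrite !mulmx1 !mulmx0 !mul1mx !mul0mx !add0r.
have {}L := free nm0 n0 UZ UX L; have {}T := free m0 nm0 UY UZ T.
apply: rcomp_inj => i; rewrite rcompK [rcomp (offdiag _ _ _) i]rcomp_urtuple.
rewrite -[LHS]/(comp _ i); move: (L i) (T i).
rewrite -[comp (f (utri X H Y)) i]submxK mul_block_col mul_col_mx mul_row_block mul_mx_row.
rewrite !mulmx1 !mulmx0 !mul1mx !mul0mx !addr0 !add0r block_mxKur.
by move=> /eq_col_mx[-> ->] /eq_row_mx[_ <-].
Qed.

(** The block diagonal matrix [diag(G, 1)] intertwines the two triangular tuples. A scalar [G] will
    give homogeneity of the corner in [H], and a row of two scalar blocks its additivity. *)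
Lemma offdiag_intertwines {n n' m : nat} (X : ncmx R n g) (X' : ncmx R n' g)
    (H : 'M[C]_(g, n * m)) (H' : 'M[C]_(g, n' * m)) (Y : ncmx R m g) (G : 'M[C]_(n', n)) :
  (0 < n)%N -> (0 < n')%N -> (0 < m)%N -> U X -> U X' -> U Y ->
  U (utri X H Y) -> U (utri X' H' Y) ->
  intertwines X' G X -> (forall i, rcomp H' i = G *m rcomp H i) ->
  forall i, rcomp (offdiag X' H' Y) i = G *m rcomp (offdiag X H Y) i.
Proof.
move=> n0 n0' m0 UX UX' UY UZ UZ' XGX HG i.
have I : intertwines (utri X' H' Y) (block_mx G 0 0 1%:M) (utri X H Y).
  move=> j; rewrite !comp_utri !mulmx_block XGX HG.
  by rewrite !mulmx1 !mulmx0 !mul1mx !mul0mx !addr0 !add0r.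
have nm0 : (0 < n + m)%N by rewrite addn_gt0 n0.
have nm0' : (0 < n' + m)%N by rewrite addn_gt0 n0'.
move: (free nm0' nm0 UZ' UZ I i); rewrite !free_utri // !comp_utri !mulmx_block.
rewrite !mulmx1 !mulmx0 !mul0mx !addr0 !add0r.
by move=> /eq_block_mx[_ ->].
Qed.

(** The condition on [H] says that the column [(- G; 1)] intertwines the triangular tuple with [Y];
    freeness carries the same relation over to the values. *)
Lemma offdiag_commutator {n m : nat} (X : ncmx R n g) (H : 'M[C]_(g, n * m))
    (Y : ncmx R m g) (G : 'M[C]_(n, m)) :
  (0 < n)%N -> (0 < m)%N -> U X -> U Y -> U (utri X H Y) ->
  (forall i, rcomp H i = comp X i *m G - G *m comp Y i) ->
  forall i, rcomp (offdiag X H Y) i = comp (f X) i *m G - G *m comp (f Y) i.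
Proof.
move=> n0 m0 UX UY UZ HG i.
have I : intertwines (utri X H Y) (col_mx (- G) 1%:M) Y.
  move=> j; rewrite comp_utri HG mul_block_col mul_col_mx.
  by rewrite !mulmx1 !mul0mx !mul1mx add0r mulmxN mulNmx addKr.
have nm0 : (0 < n + m)%N by rewrite addn_gt0 n0.
move: (free nm0 m0 UZ UY I i); rewrite free_utri // comp_utri mul_block_col mul_col_mx.
rewrite !mulmx1 mulmxN mulNmx => /eq_col_mx[+ _].
by move/(canRL (addKr _)); rewrite opprK.
Qed.

End FreeMaps.

Arguments offdiag {R g gt} f {n m} X H Y.

(** * Real-valued norms and compactness in complex matrix spaces *)

Section ComplexMatrices.
Context {R : realType}.
Local Notation C := R[i].

Lemma mx_linear_continuous {V : normedModType C} {m n : nat}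
    (phi : {linear 'M[C]_(m, n) -> V}) : continuous phi.
Proof.
have -> : (phi : 'M[C]_(m, n) -> V) =
    (fun M => \sum_i \sum_j M i j *: phi (delta_mx i j)).
  apply/funext => M; rewrite {1}[M]matrix_sum_delta linear_sum; apply: eq_bigr => i _.
  by rewrite linear_sum; apply: eq_bigr => j _; rewrite linearZ.
have addc : continuous (fun x : V * V => x.1 + x.2) by exact: add_continuous.
move=> M; apply: (@cvg_big V _ _ _ _ addc _ (nbhs M) _ _ _ (nbhs_filter M)) => i _.
apply: (@cvg_big V _ _ _ _ addc _ (nbhs M) _ _ _ (nbhs_filter M)) => j _.
by apply: (@cvgZr_tmp _ _ _ (nbhs M) (nbhs_filter M)); exact: coord_continuous.
Qed.

(* The norm of a [C]-normed module has values in [C]. *)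
Definition rnorm {V : normedModType C} (x : V) : R := complex.Re `|x|.

Lemma rnormE {V : normedModType C} (x : V) : (rnorm x)%:C%C = `|x|.
Proof. by rewrite /rnorm; apply: RRe_real; exact: ger0_real. Qed.

Lemma rnorm_ge0 {V : normedModType C} (x : V) : 0 <= rnorm x.
Proof. by rewrite -lecR rnormE; exact: normr_ge0. Qed.

Lemma rnorm_eq0 {V : normedModType C} (x : V) : rnorm x = 0 -> x = 0.
Proof. by move=> x0; apply/eqP; rewrite -normr_eq0 -rnormE x0. Qed.

Lemma rnormD {V : normedModType C} (x y : V) : rnorm (x + y) <= rnorm x + rnorm y.
Proof. by rewrite -lecR rmorphD /= !rnormE ler_normD. Qed.

Lemma rnormN {V : normedModType C} (x : V) : rnorm (- x) = rnorm x.
Proof. by rewrite /rnorm normrN. Qed.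

Lemma rnormZ {V : normedModType C} (a : R) (x : V) :
  rnorm (a%:C%C *: x) = `|a| * rnorm x.
Proof.
apply: (@complexI R); rewrite rmorphM /= !rnormE normrZ; congr (_ * _).
by rewrite normc_def /= expr0n addr0 sqrtr_sqr.
Qed.

Lemma near_rnorm {V : normedModType C} (x : V) (e : R) :
  0 < e -> \forall y \near x, rnorm (y - x) < e.
Proof.
move=> e0; apply/nbhs_ballP; exists e%:C%C; first by rewrite /= ltcR.
by move=> y; rewrite -ball_normE /= distrC -rnormE ltcR.
Qed.

Lemma rnorm_nbhs {V : normedModType C} (x : V) (A : set V) :
  nbhs x A -> exists2 e : R, 0 < e & forall y, rnorm (y - x) < e -> A y.
Proof.
move=> /nbhs_ballP[e /= e0 eA].
have eE : (complex.Re e)%:C%C = e by apply: RRe_real; exact: gtr0_real.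
exists (complex.Re e); first by rewrite -ltcR eE.
by move=> y xy; apply: eA; rewrite -ball_normE /= distrC -rnormE -eE ltcR.
Qed.

Lemma rnorm_continuous {V : normedModType C} : continuous (@rnorm V).
Proof.
move=> x; apply/(@cvgrPdist_lt _ R) => e e0.
near=> y; have xy : rnorm (y - x) < e by near: y; exact: near_rnorm.
apply: le_lt_trans xy; rewrite ler_norml.
have := rnormD (y - x) x; have := rnormD (x - y) y; rewrite !subrK.
rewrite -(rnormN (x - y)) opprB => h1 h2.
by apply/andP; split; lra.
Unshelve. all: by end_near. Qed.

Lemma rdist_continuous {V : normedModType C} (z : V) :
  continuous (fun w : V => rnorm (w - z)).
Proof.
move=> w; apply: (@continuous_comp _ _ _ (fun w => w - z) rnorm); last exact: rnorm_continuous.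
apply: (@cvgB C V _ (nbhs w) (nbhs_filter w)); [exact: cvg_id|exact: cvg_cst].
Qed.

Lemma real_complex_continuous : continuous (fun t : R => t%:C%C : C).
Proof.
move=> x A /nbhs_ballP[e /= e0 eA].
have eE : (complex.Re e)%:C%C = e by apply: RRe_real; exact: gtr0_real.
apply/nbhs_ballP; exists (complex.Re e); first by rewrite /= -ltcR eE.
move=> y xy; apply: eA; change (`|x%:C%C - y%:C%C| < e).
by rewrite -rmorphB /= normc_def /= expr0n addr0 sqrtr_sqr -eE ltcR.
Qed.

(** The disc is a closed part of the image of the square [[-r, r]^2] under the continuous map
    [a, b |-> a + i b]. *)
Lemma compact_disc (r : R) : compact [set z : C | rnorm (z : C^o) <= r].
Proof.
pose q (p : R * R) : C := p.1%:C%C + 'i%C * p.2%:C%C.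
have cq : continuous q.
  move=> p; apply: (@cvgD C C^o _ (nbhs p)).
    by apply: cvg_comp; [exact: cvg_fst|exact: real_complex_continuous].
  apply: (@cvgMl_tmp C _ (nbhs p)).
  by apply: cvg_comp; [exact: cvg_snd|exact: real_complex_continuous].
have cI : compact (q @` (`[- r, r] `*` `[- r, r])).
  apply: continuous_compact; first exact: continuous_subspaceT.
  by apply: compact_setX; exact: segment_compact.
apply: (subclosed_compact _ cI).
  apply: (@closed_comp _ _ (@rnorm C^o) [set t | t <= r]); last exact: closed_le.
  by move=> z _; exact: rnorm_continuous.
move=> [a b]; rewrite /= /rnorm normc_def /= => h.
exists (a, b); rewrite /= ?in_itv /= -?ler_norml.
  split; apply: le_trans h; rewrite -sqrtr_sqr ler_wsqrtr //.
    by rewrite lerDl sqr_ge0.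
  by rewrite lerDr sqr_ge0.
by rewrite /q [RHS]complexE.
Qed.

Lemma mx_entry_norm_le {m n : nat} (M : 'M[C]_(m, n)) i j : `|M i j| <= `|M|.
Proof.
rewrite [leRHS]/Num.norm /= mx_normE.
rewrite -[leLHS]nngE num_le.
exact: (@le_bigmax _ _ _ _ (fun ij : 'I_m * 'I_n => `|M ij.1 ij.2|%:nng) (i, j)).
Qed.

(** Entries are bounded by the norm, so the ball is a closed part of a translated product of compact
    discs. *)
Lemma compact_rball {m n : nat} (Z : 'M[C]_(m, n)) (r : R) :
  compact [set W | rnorm (W - Z) <= r].
Proof.
have cI : compact ((fun v => vec_mx v + Z) @`
    [set v : 'rV[C]_(m * n) | forall i, rnorm (v ord0 i : C^o) <= r]).
  apply: continuous_compact.
    apply: continuous_subspaceT => v.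
    apply: (@cvgD C 'M[C]_(m, n) _ (nbhs v) (nbhs_filter v)); last exact: cvg_cst.
    exact: mx_linear_continuous.
  by apply: (@rV_compact C _ (fun=> [set z : C | rnorm (z : C^o) <= r])) => i; exact: compact_disc.
apply: (subclosed_compact _ cI).
  exact: ((continuous_closedP _).1 (@rdist_continuous _ Z) _ (@closed_le R r)).
move=> W /= WZ; exists (mxvec (W - Z)); last by rewrite mxvecK subrK.
move=> k; apply: le_trans WZ; rewrite -lecR !rnormE.
case/mxvec_indexP: k => i j; rewrite mxvecE.
exact: mx_entry_norm_le.
Qed.

End ComplexMatrices.

(** * Reflecting intertwining relations through compact fibres *)

Section Injectivity.
Context {R : realType}.
Local Notation C := R[i].

Lemma linear_mx_continuous {V : normedModType C} {m n : nat} (phi : 'M[C]_(m, n) -> V) :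
  linear phi -> continuous phi.
Proof.
move=> lin; pose L := GRing.isLinear.Build C _ V *:%R phi lin.
pose phiL : {linear 'M[C]_(m, n) -> V} := HB.pack phi L.
exact: (@mx_linear_continuous _ _ _ _ phiL).
Qed.

Lemma utri_cvg {T : Type} {F : set_system T} {FF : Filter F} {g n m : nat}
    (X : T -> ncmx R n g) (H : T -> 'M[C]_(g, n * m)) (Y : T -> ncmx R m g)
    (X0 : ncmx R n g) (H0 : 'M[C]_(g, n * m)) (Y0 : ncmx R m g) :
  X @ F --> X0 -> H @ F --> H0 -> Y @ F --> Y0 ->
  utri (X t) (H t) (Y t) @[t --> F] --> utri X0 H0 Y0.
Proof.
(* Joint continuity follows by splitting into three linear, hence continuous, pieces. *)
have utriE (A : ncmx R n g) (B : 'M[C]_(g, n * m)) (D : ncmx R m g) :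
    utri A B D = utri A 0 0 + utri 0 B 0 + utri 0 0 D.
  by rewrite -[utri A 0 0]scale1r -utriP -[X in X + _]scale1r -utriP !scaler0 !scale1r
    !(addr0, add0r).
move=> cX cH cY; rewrite utriE; under eq_cvg do rewrite utriE.
have lX : linear (fun A : ncmx R n g => utri A 0 0 : ncmx R (n + m) g).
  by move=> a A B; rewrite -utriP !scaler0 !addr0.
have lH : linear (fun A : 'M[C]_(g, n * m) => utri 0 A 0 : ncmx R (n + m) g).
  by move=> a A B; rewrite -utriP !scaler0 !addr0.
have lY : linear (fun A : ncmx R m g => utri 0 0 A : ncmx R (n + m) g).
  by move=> a A B; rewrite -utriP !scaler0 !addr0.
apply: (@cvgD C (ncmx R (n + m) g) _ F FF); first apply: (@cvgD C (ncmx R (n + m) g) _ F FF).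
- exact: (@cvg_comp _ _ _ X (fun A => utri A 0 0) _ _ _ cX (@linear_mx_continuous _ _ _ _ lX X0)).
- exact: (@cvg_comp _ _ _ H (fun A => utri 0 A 0) _ _ _ cH (@linear_mx_continuous _ _ _ _ lH H0)).
- exact: (@cvg_comp _ _ _ Y (fun A => utri 0 0 A) _ _ _ cY (@linear_mx_continuous _ _ _ _ lY Y0)).
Qed.

Lemma urtuple_continuous {g n m : nat} : continuous (@urtuple R g n m).
Proof. by apply: linear_mx_continuous => a A B; exact: urtupleP. Qed.

Lemma real_scale_continuous {V : normedModType C} (v : V) :
  continuous (fun t : R => t%:C%C *: v).
Proof.
move=> t; apply: (@continuous_comp _ _ _ (fun t : R => t%:C%C : C) (fun c => c *: v)).
  exact: real_complex_continuous.
exact: scalel_continuous.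
Qed.

Context {g gt : nat} {U : forall n, set (ncmx R n g)}
  {f : forall n, ncmx R n g -> ncmx R n gt}.
Hypothesis ncU : nc_set U.
Hypothesis free : free_map U f.

Lemma free_dsum {n m : nat} (X : ncmx R n g) (Y : ncmx R m g) :
  (0 < n)%N -> (0 < m)%N -> U X -> U Y -> f (dsum X Y) = dsum (f X) (f Y).
Proof.
move=> n0 m0 UX UY; have UZ := ncU.2 n m X Y n0 m0 UX UY.
rewrite dsum_utri in UZ *; rewrite dsum_utri (free_utri free) //; congr utri.
apply: rcomp_inj => i; rewrite (offdiag_commutator free (G := 0)) // => [|j];
  by rewrite ?rcomp0 mulmx0 mul0mx subr0.
Qed.

(* [utri X (t *: H) Y] with [H = X G - G Y] is similar to [X (+) Y], so as long
   as it stays in [U] it lies in the fibre of [f X (+) f Y]; by compactness of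
   the fibre it never leaves [U], and boundedness of the fibre forces [H = 0]. *)
Lemma free_intertwines_inv {n m : nat} (X : ncmx R n g) (Y : ncmx R m g) (G : 'M[C]_(n, m))
    (K : set (ncmx R (n + m) g)) :
  (0 < n)%N -> (0 < m)%N -> U X -> U Y -> open (U (n := n + m)) ->
  compact K -> K `<=` U (n := n + m) ->
  (forall Z, U Z -> f Z = dsum (f X) (f Y) -> K Z) ->
  intertwines (f X) G (f Y) -> intertwines X G Y.
Proof.
move=> n0 m0 UX UY oU cK KU fib fG.
pose H : 'M[C]_(g, n * m) := mktuple (fun i => comp X i *m G - G *m comp Y i).
suff H0 : H = 0.
  move=> i; apply/eqP; rewrite -subr_eq0; apply/eqP.
  by rewrite -[LHS](rcompK (fun i => comp X i *m G - G *m comp Y i)) -/H H0 rcomp0.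
pose Z (t : R) := utri X (t%:C%C *: H) Y.
have cZ : continuous Z.
  move=> t; apply: (@utri_cvg _ (nbhs t) (nbhs_filter t)); [exact: cvg_cst| |exact: cvg_cst].
  exact: real_scale_continuous.
(* Since [t H = X (t G) - (t G) Y], the corner of [f (Z t)] is [t (f X G - G f Y) = 0]. *)
have UK t : U (Z t) -> K (Z t).
  move=> UZ; apply: fib => //; rewrite dsum_utri (free_utri free) //; congr utri.
  apply: rcomp_inj => i; rewrite rcomp0 (offdiag_commutator free (G := t%:C%C *: G)) //.
    by rewrite -scalemxAr -scalemxAl -scalerBr fG subrr scaler0.
  by move=> j; rewrite rcompZ rcompK -scalemxAr -scalemxAl -scalerBr.
(* This set is open as a preimage of [U], closed because it is also the preimage of the compact set
   [K], and contains 0 because [Z 0] is a direct sum. *)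
have allU : [set t | U (Z t)] = setT.
  have : connected [set: R] by apply/connected_intervalP.
  apply.
  - exists 0; rewrite /= /Z scale0r -dsum_utri; exact: ncU.2.
  - exists [set t | U (Z t)]; last by rewrite setTI.
    exact: ((continuousP _).1 cZ _ oU).
  - exists [set t | K (Z t)].
      apply: ((continuous_closedP _).1 cZ).
      by apply: compact_closed cK; exact: norm_hausdorff.
    by rewrite setTI; apply/seteqP; split=> t; [exact: UK|exact: KU].
have allK (t : R) : K (Z t).
  by apply: UK; rewrite -[U _]/([set t | U (Z t)] t) allU.
have /compact_has_sup : compact ((rnorm \o @urtuple R g n m) @` K).
  apply: continuous_compact cK; apply: continuous_subspaceT => W.
  by apply: continuous_comp; [exact: urtuple_continuous|exact: rnorm_continuous].
case.
  by exists (rnorm (urtuple (Z 0))), (Z 0).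
move=> _ [s sP].
have bnd (t : R) : `|t| * rnorm H <= s.
  by apply: sP; exists (Z t) => //; rewrite /= urtuple_utri rnormZ.
(* For nonzero [H] the value [t = (s + 1) / rnorm H] would violate [bnd]. *)
apply: rnorm_eq0; apply/eqP; apply/negPn/negP => H0.
have := le_trans (ler_wpM2r (rnorm_ge0 H) (ler_norm _)) (bnd ((s + 1) / rnorm H)).
by rewrite divfK //; lra.
Qed.

End Injectivity.

(** * The inverse of a map that reflects intertwining relations *)

Section Inverse.
Context {R : realType} {g gt : nat} {U : forall n, set (ncmx R n g)}
  {f : forall n, ncmx R n g -> ncmx R n gt}.
Local Notation C := R[i].

Lemma intertwines1 {k n : nat} (X Y : ncmx R n k) : intertwines X 1%:M Y <-> X = Y.
Proof.
split=> [XY|-> i]; last by rewrite mulmx1 mul1mx.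
by apply: rcomp_inj => i; have := XY i; rewrite mulmx1 mul1mx.
Qed.

(** Unitary conjugation becomes an intertwining relation, so that freeness of [f] makes its image
    stable under conjugation. *)
Lemma uconjP {k n : nat} (W : 'M[C]_n) (X Y : ncmx R n k) :
  unitarymx W -> intertwines Y (mxadj W) X <-> Y = uconj W X.
Proof.
move=> unW; have unW' : W *m mxadj W = 1%:M by exact: mulmx1C.
have compE i : comp (uconj W X) i = mxadj W *m comp X i *m W by exact: rcompK.
split=> [YX|-> i]; last by rewrite compE -mulmxA unW' mulmx1.
apply: rcomp_inj => i; rewrite -[RHS]/(comp _ i) compE -YX -mulmxA unW mulmx1.
by [].
Qed.

Hypothesis ncU : nc_set U.
Hypothesis free : free_map U f.

Lemma image_nc_set : nc_set (image_nc U f).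
Proof.
split=> [n W _ n0 [X UX <-] unW|n m _ _ n0 m0 [X UX <-] [Y UY <-]].
  exists (uconj W X); first exact: ncU.1.
  apply/uconjP => //; apply: free => //; first exact: ncU.1.
  exact/uconjP.
exists (dsum X Y); first exact: ncU.2.
exact: (free_dsum ncU free).
Qed.

Hypothesis inv : forall n m (X : ncmx R n g) (Y : ncmx R m g) (G : 'M[C]_(n, m)),
  (0 < n)%N -> (0 < m)%N -> U X -> U Y ->
  intertwines (f X) G (f Y) -> intertwines X G Y.

Lemma free_one_to_one : one_to_one U f.
Proof.
move=> n n0 X Y UX UY fXY; apply/intertwines1; apply: inv => //.
exact/intertwines1.
Qed.

(** On the image [xget] chooses a preimage; elsewhere the value is the default 0. *)
Definition inverse_map (V : forall n, set (ncmx R n g))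
    (phi : forall n, ncmx R n g -> ncmx R n gt) n (Z : ncmx R n gt) : ncmx R n g :=
  xget 0 [set X | V n X /\ phi n X = Z].

Lemma inverse_mapK n : (0 < n)%N ->
  forall Z : ncmx R n gt, image_nc U f Z -> U (inverse_map U f Z) /\ f (inverse_map U f Z) = Z.
Proof.
move=> n0 _ [X UX <-]; rewrite /inverse_map.
by case: xgetP => [W _ [UW fW]|/(_ X)/=[]].
Qed.

Lemma inverse_map_left n : (0 < n)%N -> forall X : ncmx R n g, U X -> inverse_map U f (f X) = X.
Proof.
move=> n0 X UX; have [UW fW] := inverse_mapK n0 (imageP (f (n := n)) UX).
exact: free_one_to_one fW.
Qed.

Lemma inverse_map_free : free_map (image_nc U f) (inverse_map U f).
Proof.
move=> n m Z W G n0 m0 fZ fW ZW.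
have [UZ fZK] := inverse_mapK n0 fZ; have [UW fWK] := inverse_mapK m0 fW.
by apply: inv => //; rewrite fZK fWK.
Qed.

Lemma free_map_inverse :
  one_to_one U f /\ nc_set (image_nc U f) /\
  exists h : forall n, ncmx R n gt -> ncmx R n g,
    (forall n, (0 < n)%N -> forall X : ncmx R n g, U X -> h n (f X) = X) /\
    free_map (image_nc U f) h.
Proof.
split; first exact: free_one_to_one.
split; first exact: image_nc_set.
exists (inverse_map U f); split; [exact: inverse_map_left|exact: inverse_map_free].
Qed.

End Inverse.

(** * Compact fibres, from properness or by assumption *)

Section ProperMaps.
Context {R : realType} {g gt : nat} {U : forall n, set (ncmx R n g)}
  {V : forall n, set (ncmx R n gt)} {f : forall n, ncmx R n g -> ncmx R n gt}.
Local Notation C := R[i].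
Hypothesis domU : nc_domain U.
Hypothesis free : free_map U f.

(** [V] is closed under direct sums, so the single point [dsum (f X) (f Y)] is a compact subset of
    it and its fibre is compact in [U]. *)
Lemma proper_intertwines_inv :
  nc_set V -> maps_into U V f -> proper_map U V f ->
  forall n m (X : ncmx R n g) (Y : ncmx R m g) (G : 'M[C]_(n, m)),
  (0 < n)%N -> (0 < m)%N -> U X -> U Y ->
  intertwines (f X) G (f Y) -> intertwines X G Y.
Proof.
move=> ncV fUV fp n m X Y G n0 m0 UX UY.
have nm0 : (0 < n + m)%N by rewrite addn_gt0 n0.
apply: (free_intertwines_inv domU.1 free n0 m0 UX UY (domU.2 _ nm0).1 
  (K := U (n := n + m) `&` f (n := n + m) @^-1` [set dsum (f X) (f Y)])) => //.
  apply: fp => //; last exact: compact_set1.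
  by move=> _ ->; apply: ncV.2 => //; exact: fUV.
Qed.

Lemma compact_fiber_intertwines_inv :
  (forall n, (0 < n)%N -> forall Z : ncmx R n gt,
    compact (closure (U (n := n) `&` f (n := n) @^-1` [set Z])) /\
    closure (U (n := n) `&` f (n := n) @^-1` [set Z]) `<=` U (n := n)) ->
  forall n m (X : ncmx R n g) (Y : ncmx R m g) (G : 'M[C]_(n, m)),
  (0 < n)%N -> (0 < m)%N -> U X -> U Y ->
  intertwines (f X) G (f Y) -> intertwines X G Y.
Proof.
move=> fib n m X Y G n0 m0 UX UY.
have nm0 : (0 < n + m)%N by rewrite addn_gt0 n0.
have [cK KU] := fib _ nm0 (dsum (f X) (f Y)).
apply: (free_intertwines_inv domU.1 free n0 m0 UX UY (domU.2 _ nm0).1 cK KU).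
by move=> Z UZ fZ; apply: subset_closure.
Qed.

End ProperMaps.

(** * Bounds for linear maps, uniform radii and stacked tuples *)

Section MatrixEstimates.
Context {R : realType}.
Local Notation C := R[i].

Lemma real_complex_neq0 (s : R) : 0 < s -> s%:C%C != 0 :> C.
Proof. by move=> s0; rewrite (fmorph_eq0 (real_complex R)) gt_eqF. Qed.

(** Expand [M] in matrix units: each of the [m * n] terms has norm at most [e * rnorm M]. *)
Lemma linear_mx_bound {V : normedModType C} {m n : nat}
    (L : 'M[C]_(m, n) -> V) (e : R) :
  linear L -> (forall i j, rnorm (L (delta_mx i j)) <= e) ->
  forall M, rnorm (L M) <= (m * n)%:R * e * rnorm M.
Proof.
move=> lin Le M; pose LL := GRing.isLinear.Build C _ V *:%R L lin.
pose phi : {linear 'M[C]_(m, n) -> V} := HB.pack L LL.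
rewrite -lecR rnormE -[L]/(phi : _ -> _) {1}[M]matrix_sum_delta linear_sum.
have -> : ((m * n)%:R * e * rnorm M)%:C%C = \sum_(i < m) \sum_(j < n) `|M| * e%:C%C.
  rewrite !sumr_const !card_ord -mulrnA (mulnC n) -[RHS]mulr_natl !rmorphM /= !rmorph_nat.
  by rewrite rnormE -mulrA; congr (_ * _ * _); exact: mulrC.
apply: le_trans (ler_norm_sum _ _ _) _; apply: ler_sum => i _.
rewrite linear_sum; apply: le_trans (ler_norm_sum _ _ _) _; apply: ler_sum => j _.
rewrite linearZ /= normrZ; apply: ler_pM => //; first exact: mx_entry_norm_le.
by rewrite -rnormE lecR.
Qed.

Lemma near_open3 {m1 m2 m3 k1 k2 k3 k m : nat}
    (psi : 'M[C]_(k1, m1) -> 'M[C]_(k2, m2) -> 'M[C]_(k3, m3) -> 'M[C]_(k, m))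
    (O : set 'M[C]_(k, m)) (A : 'M[C]_(k1, m1)) (B : 'M[C]_(k2, m2)) (D : 'M[C]_(k3, m3)) :
  open O -> O (psi A B D) ->
  (psi p.1 p.2.1 p.2.2 @[p --> (A, (B, D))] --> psi A B D) ->
  exists2 r : R, 0 < r & forall A' B' D', rnorm (A' - A) < r -> rnorm (B' - B) < r ->
    rnorm (D' - D) < r -> O (psi A' B' D').
Proof.
move=> oO OABD cpsi.
have /cpsi : nbhs (psi A B D) O by exact: open_nbhs_nbhs.
move=> [[P Q] /= [nP [[Q1 Q2] /= [nQ1 nQ2] Q12]] PQ].
have [r1 r10 r1P] := rnorm_nbhs nP.
have [r2 r20 r2P] := rnorm_nbhs nQ1.
have [r3 r30 r3P] := rnorm_nbhs nQ2.
exists (Num.min r1 (Num.min r2 r3)); first by rewrite !lt_min r10 r20.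
move=> A' B' D'; rewrite !lt_min => /and3P[? _ _] /and3P[_ ? _] /and3P[_ _ ?].
apply: (PQ (A', (B', D'))); split => /=; first exact: r1P.
by apply: (Q12 (B', D')); split; [exact: r2P|exact: r3P].
Qed.

Definition stack {k p q m : nat} (H : 'M[C]_(k, p * m)) (K : 'M[C]_(k, q * m)) :
  'M[C]_(k, (p + q) * m) := mktuple (fun i => col_mx (rcomp H i) (rcomp K i)).

Lemma stackP {k p q m : nat} (a : C) (H H' : 'M[C]_(k, p * m)) (K K' : 'M[C]_(k, q * m)) :
  stack (a *: H + H') (a *: K + K') = a *: stack H K + stack H' K'.
Proof.
apply: rcomp_inj => i; rewrite rcompZD !rcompK !rcompZD.
by rewrite scale_col_mx add_col_mx.
Qed.

Lemma stack_cvg {T : Type} {F : set_system T} {FF : Filter F} {k p q m : nat}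
    (H : T -> 'M[C]_(k, p * m)) (K : T -> 'M[C]_(k, q * m)) H0 K0 :
  H @ F --> H0 -> K @ F --> K0 -> stack (H t) (K t) @[t --> F] --> stack H0 K0.
Proof.
have stackE (A : 'M[C]_(k, p * m)) (B : 'M[C]_(k, q * m)) :
    stack A B = stack A 0 + stack 0 B.
  by rewrite -[stack A 0]scale1r -stackP !scale1r add0r addr0.
move=> cH cK; rewrite stackE; under eq_cvg do rewrite stackE.
have lH : linear (fun A : 'M[C]_(k, p * m) => stack A 0 : 'M[C]_(k, (p + q) * m)).
  by move=> a A B; rewrite -stackP !scaler0 !addr0.
have lK : linear (fun A : 'M[C]_(k, q * m) => stack 0 A : 'M[C]_(k, (p + q) * m)).
  by move=> a A B; rewrite -stackP !scaler0 !addr0.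
apply: (@cvgD C 'M[C]_(k, (p + q) * m) _ F FF).
- exact: (@cvg_comp _ _ _ H (fun A => stack A 0) _ _ _ cH (@linear_mx_continuous _ _ _ _ _ lH H0)).
- exact: (@cvg_comp _ _ _ K (fun A => stack 0 A) _ _ _ cK (@linear_mx_continuous _ _ _ _ _ lK K0)).
Qed.

End MatrixEstimates.

(** * The derivative of a continuous free map *)

Section Derivative.
Context {R : realType} {g gt : nat} {U : forall n, set (ncmx R n g)}
  {f : forall n, ncmx R n g -> ncmx R n gt}.
Local Notation C := R[i].
Hypothesis domU : nc_domain U.
Hypothesis free : free_map U f.
Context {n : nat} {X : ncmx R n g}.
Hypothesis n0 : (0 < n)%N.
Hypothesis UX : U X.

(** At [Y = X] and [H = K = 0] the three tuples are direct sums of one, two and three copies of [X],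
    which lie in the open levels of [U]; continuity of the block constructions gives a common
    radius. *)
Lemma near_utri : exists2 r : R, 0 < r &
  forall (Y : ncmx R n g) (H K : 'M[C]_(g, n * n)), rnorm (Y - X) < r -> rnorm H < r ->
    rnorm K < r -> [/\ U Y, U (utri Y H X) & U (utri (dsum Y Y) (stack H K) X)].
Proof.
have ncU := domU.1.
have nn0 : (0 < n + n)%N by rewrite addn_gt0 n0.
have nnn0 : (0 < n + n + n)%N by rewrite addn_gt0 nn0.
pose F := nbhs (X, (0 : 'M[C]_(g, n * n), 0 : 'M[C]_(g, n * n))).
have FF : Filter F := nbhs_filter _.
have c1 : p.1 @[p --> F] --> X by exact: cvg_fst.
have c2 : p.2.1 @[p --> F] --> (0 : 'M[C]_(g, n * n)).
  exact: (@cvg_comp _ _ _ snd fst F _ _ cvg_snd cvg_fst).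
have c3 : p.2.2 @[p --> F] --> (0 : 'M[C]_(g, n * n)).
  exact: (@cvg_comp _ _ _ snd snd F _ _ cvg_snd cvg_snd).
have stack0 : stack 0 0 = 0 :> 'M[C]_(g, (n + n) * n).
  by apply: rcomp_inj => i; rewrite rcompK !rcomp0 col_mx0.
have [r1 r10 r1P] := near_open3 (psi := fun Y _ _ => Y) (domU.2 n n0).1 UX c1.
have [|r2 r20 r2P] := near_open3 (psi := fun Y H _ => utri Y H X) (domU.2 _ nn0).1 _
    (utri_cvg c1 c2 (cvg_cst X)).
  by rewrite -dsum_utri; exact: ncU.2.
have c4 : dsum p.1 p.1 @[p --> F] --> dsum X X.
  rewrite dsum_utri; under eq_cvg do rewrite dsum_utri.
  exact: (@utri_cvg _ _ F FF _ _ _ _ _ _ _ _ _ c1 (cvg_cst _) c1).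
have cHK := @stack_cvg R _ F FF _ _ _ _ _ _ _ _ c2 c3.
have c5 := @utri_cvg _ _ F FF _ _ _ _ _ _ _ _ _ c4 cHK (cvg_cst X).
have [|r3 r30 r3P] := near_open3 (psi := fun Y H K => utri (dsum Y Y) (stack H K) X)
    (domU.2 _ nnn0).1 _ (c5 FF).
  by rewrite stack0 -dsum_utri; apply: ncU.2 => //; exact: ncU.2.
exists (Num.min r1 (Num.min r2 r3)); first by rewrite !lt_min r10 r20.
move=> Y H K; rewrite !lt_min => /and3P[Y1 Y2 Y3] /and3P[H1 H2 H3] /and3P[K1 K2 K3].
split; first by apply: (r1P Y H K); rewrite // subr0.
  by apply: (r2P Y H K); rewrite // subr0.
by apply: (r3P Y H K); rewrite // subr0.
Qed.

Section DifferenceQuotient.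
Context {r : R}.
Hypothesis r0 : 0 < r.
Hypothesis rP : forall (Y : ncmx R n g) (H K : 'M[C]_(g, n * n)),
  rnorm (Y - X) < r -> rnorm H < r -> rnorm K < r ->
  [/\ U Y, U (utri Y H X) & U (utri (dsum Y Y) (stack H K) X)].

(** The scalar matrix [c%:M] intertwines [Y] with itself and multiplies the corner by [c]. *)
Lemma offdiagZ (c : C) (Y : ncmx R n g) (H : 'M[C]_(g, n * n)) :
  rnorm (Y - X) < r -> rnorm H < r -> rnorm (c *: H) < r ->
  offdiag f Y (c *: H) X = c *: offdiag f Y H X.
Proof.
move=> rY rH rcH; have [UY UH _] := rP rY rH rH; have [_ UcH _] := rP rY rcH rcH.
apply: rcomp_inj => i; rewrite (offdiag_intertwines free (X := Y) (H := H) (G := c%:M)) //.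
- by rewrite rcompZ mul_scalar_mx.
- by move=> j; rewrite scalar_mxC.
- by move=> j; rewrite rcompZ mul_scalar_mx.
Qed.

(* Each of the three corners is read off from [[Y (+) Y, (H; K)], [0, X]]. *)
Lemma offdiagD (Y : ncmx R n g) (H K : 'M[C]_(g, n * n)) :
  rnorm (Y - X) < r -> rnorm H < r -> rnorm K < r -> rnorm (H + K) < r ->
  offdiag f Y (H + K) X = offdiag f Y H X + offdiag f Y K X.
Proof.
move=> rY rH rK rHK.
have [UY UH UHK2] := rP rY rH rK; have [_ UK _] := rP rY rK rK.
have [_ UHK _] := rP rY rHK rHK.
have nn0 : (0 < n + n)%N by rewrite addn_gt0 n0.
have UYY : U (dsum Y Y) by exact: domU.1.2.
have compYY i : comp (dsum Y Y) i = block_mx (comp Y i) 0 0 (comp Y i) by exact: rcompK.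
have E (a b : C) (L : 'M[C]_(g, n * n)) : U (utri Y L X) ->
    (forall i, rcomp L i = a *: rcomp H i + b *: rcomp K i) ->
    forall i, rcomp (offdiag f Y L X) i =
      row_mx a%:M b%:M *m rcomp (offdiag f (dsum Y Y) (stack H K) X) i.
  move=> UL LE; apply: (offdiag_intertwines free) => // i.
    rewrite compYY mul_row_block mul_mx_row !mulmx0 !(addr0, add0r).
    by rewrite !mul_mx_scalar !mul_scalar_mx.
  by rewrite LE rcompK mul_row_col !mul_scalar_mx.
apply: rcomp_inj => i; rewrite rcompD (E 1 1 (H + K)) // ?(E 1 0 H) ?(E 0 1 K) //.
- by rewrite -mulmxDl add_row_mx !raddf0 addr0 add0r.
- by move=> j; rewrite scale0r scale1r add0r.
- by move=> j; rewrite scale0r scale1r addr0.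
- by move=> j; rewrite rcompD !scale1r.
Qed.

(** Scaling [H] by this factor brings its norm below [r / 2]; the summand 1 keeps the denominator
    positive at [H = 0]. *)
Definition admissible_scale (H : 'M[C]_(g, n * n)) : R := r / (2 * (1 + rnorm H)).

Lemma admissible_scale_gt0 (H : 'M[C]_(g, n * n)) : 0 < admissible_scale H.
Proof.
by rewrite divr_gt0 // mulr_gt0 // ltr_pwDl // rnorm_ge0.
Qed.

Lemma admissible_scaleP (H : 'M[C]_(g, n * n)) (s : R) :
  0 < s -> s <= admissible_scale H -> rnorm (s%:C%C *: H) < r.
Proof.
move=> s0 sH; rewrite rnormZ gtr0_norm //.
have H0 : 0 < 1 + rnorm H by rewrite ltr_pwDl // rnorm_ge0.
apply: (@le_lt_trans _ _ (admissible_scale H * (1 + rnorm H))).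
  by apply: ler_pM => //; [exact: ltW|exact: rnorm_ge0|lra].
rewrite /admissible_scale invfM mulrA -mulrA mulVf ?gt_eqF // mulr1.
by move: r0; lra.
Qed.

(* Any admissible scale gives the same value: see [diffquotE]. *)
Definition diffquot (Y : ncmx R n g) (H : 'M[C]_(g, n * n)) : ncmx R n gt :=
  (admissible_scale H)%:C%C^-1 *: offdiag f Y ((admissible_scale H)%:C%C *: H) X.

Lemma diffquotE (Y : ncmx R n g) (H : 'M[C]_(g, n * n)) (s : R) :
  rnorm (Y - X) < r -> 0 < s -> rnorm (s%:C%C *: H) < r ->
  diffquot Y H = s%:C%C^-1 *: offdiag f Y (s%:C%C *: H) X.
Proof.
move=> rY s0 rsH; rewrite /diffquot; set a := admissible_scale H.
have a0 : 0 < a by exact: admissible_scale_gt0.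
have sC0 := real_complex_neq0 s0.
have aC0 := real_complex_neq0 a0.
have aE : a%:C%C *: H = (a%:C%C / s%:C%C) *: (s%:C%C *: H).
  by rewrite scalerA divfK.
rewrite aE offdiagZ // -?aE; last exact: admissible_scaleP.
by rewrite scalerA mulrA mulVf // mul1r.
Qed.

Lemma diffquot_linear (Y : ncmx R n g) : rnorm (Y - X) < r -> linear (diffquot Y).
Proof.
move=> rY a H K.
(* One scale admissible for [H], [K], [a *: H] and [a *: H + K] reduces linearity to that of the
   corner. *)
pose s := Num.min (Num.min (admissible_scale H) (admissible_scale K))
  (Num.min (admissible_scale (a *: H)) (admissible_scale (a *: H + K))).
have s0 : 0 < s by rewrite !lt_min !admissible_scale_gt0.
have : s <= s by [].
rewrite {2}/s !le_min => /andP[/andP[sH sK] /andP[saH saHK]].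
have rH := admissible_scaleP s0 sH; have rK := admissible_scaleP s0 sK.
have raH := admissible_scaleP s0 saH; have raHK := admissible_scaleP s0 saHK.
rewrite (diffquotE rY s0 rH) (diffquotE rY s0 rK) (diffquotE rY s0 raHK).
rewrite scalerDr offdiagD // -?scalerDr //.
have aE : s%:C%C *: (a *: H) = a *: (s%:C%C *: H) by rewrite !scalerA mulrC.
have raH' : rnorm (a *: (s%:C%C *: H)) < r by rewrite -aE; exact: raH.
by rewrite aE (offdiagZ rY rH raH') scalerDr !scalerA (mulrC a).
Qed.

(** An exact identity without remainder: with the scalar [G = s], the corner [s (Y - X)] equals
    [Y G - G X], so its value is [s (f Y - f X)]. *)
Lemma diffquot_sub (Y : ncmx R n g) : rnorm (Y - X) < r -> f Y - f X = diffquot Y (Y - X).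
Proof.
move=> rY; pose s := admissible_scale (Y - X).
have s0 : 0 < s := admissible_scale_gt0 _.
have sC0 := real_complex_neq0 s0.
have rs := admissible_scaleP s0 (lexx _).
have [UY UZ _] := rP rY rs rs.
apply: (canRL (scalerK sC0)); apply: rcomp_inj => i.
rewrite [RHS](offdiag_commutator free (G := s%:C%C%:M)) //.
  by rewrite rcompZ rcompB scalar_mxC mul_scalar_mx mul_scalar_mx -scalerBr.
by move=> j; rewrite rcompZ rcompB scalar_mxC !mul_scalar_mx -scalerBr.
Qed.

(** The scale depends on [H] and not on [Y], so this is continuity of [f] at level [n + n], at the
    point [utri X (s H) X]. *)
Lemma diffquot_cvg (H : 'M[C]_(g, n * n)) : continuous_map U f ->
  diffquot Y H @[Y --> X] --> diffquot X H.
Proof.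
move=> cf; have rX : rnorm (X - X) < r by rewrite subrr /rnorm normr0.
have rs := admissible_scaleP (admissible_scale_gt0 H) (lexx _).
have [_ UZ _] := rP rX rs rs.
have nn0 : (0 < n + n)%N by rewrite addn_gt0 n0.
apply: (@cvgZl_tmp C _ _ (nbhs X) (nbhs_filter X)).
have c1 : utri Y ((admissible_scale H)%:C%C *: H) X @[Y --> X] -->
    utri X ((admissible_scale H)%:C%C *: H) X.
  by apply: (@utri_cvg _ _ (nbhs X) (nbhs_filter X)); [exact: cvg_id|exact: cvg_cst|exact: cvg_cst].
exact: (@cvg_comp _ _ _ _ (fun Z => urtuple (f Z)) _ _ _ c1
  (@continuous_comp _ _ _ (f (n := n + n)) (@urtuple R gt n n) _ (cf _ nn0 _ UZ)
    (@urtuple_continuous _ _ _ _ _))).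
Qed.

(** A vanishing corner means that [utri X (s H) X] and [utri X 0 X] have the same value, so
    injectivity at level [n + n] identifies them. *)
Lemma diffquot_eq0 (H : 'M[C]_(g, n * n)) : one_to_one U f -> diffquot X H = 0 -> H = 0.
Proof.
move=> f1; have rX : rnorm (X - X) < r by rewrite subrr /rnorm normr0.
set s := admissible_scale H; have s0 : 0 < s := admissible_scale_gt0 _.
have sC0 := real_complex_neq0 s0.
have rs := admissible_scaleP s0 (lexx _).
have [_ UZ _] := rP rX rs rs.
have nn0 : (0 < n + n)%N by rewrite addn_gt0 n0.
move=> /eqP; rewrite scaler_eq0 invr_eq0 (negPf sC0) /= => /eqP D0.
have UXX : U (utri X 0 X) by rewrite -dsum_utri; exact: domU.1.2.
have : utri X (s%:C%C *: H) X = utri X 0 X.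
  apply: (f1 _ nn0) => //; rewrite (free_utri free) // D0 -[RHS]/(f (utri X 0 X)).
  by rewrite -dsum_utri (free_dsum domU.1 free) // dsum_utri.
move/(congr1 urtuple); rewrite !urtuple_utri => /eqP.
by rewrite scaler_eq0 (negPf sC0) => /eqP.
Qed.

End DifferenceQuotient.

(** By [diffquot_sub] the remainder is [(L_Y - L_X)(Y - X)]. The linear map [L_Y - L_X] is small
    near [X] because it is small on each of the finitely many matrix units. *)
Lemma free_derivative : continuous_map U f ->
  exists2 L : ncmx R n g -> ncmx R n gt, linear L &
    (forall e : R, 0 < e ->
      \forall Y \near X, rnorm (f Y - f X - L (Y - X)) <= e * rnorm (Y - X)) /\
    (one_to_one U f -> forall H, L H = 0 -> H = 0).
Proof.
move=> cf; have [r r0 rP] := near_utri.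
have rX : rnorm (X - X) < r by rewrite subrr /rnorm normr0.
exists (diffquot (r := r) X); first exact: (diffquot_linear r0 rP).
split=> [e e0|f1 H]; last exact: (diffquot_eq0 r0 rP).
(* [N] counts the matrix units; the share [e / N.+1] per unit has a positive denominator and sums to
   at most [e]. *)
pose N := (g * (n * n))%N.
have dlim i j : \forall Y \near X,
    rnorm (diffquot (r := r) Y (delta_mx i j) - diffquot (r := r) X (delta_mx i j)) <
    e / N.+1%:R.
  have eN : 0 < e / N.+1%:R by rewrite divr_gt0.
  have := @near_rnorm _ (ncmx R n gt) (diffquot (r := r) X (delta_mx i j)) _ eN.
  exact: (@diffquot_cvg r r0 rP (delta_mx i j) cf).
have dlimA : \forall Y \near X, forall ij : 'I_g * 'I_(n * n),
    rnorm (diffquot (r := r) Y (delta_mx ij.1 ij.2) - diffquot (r := r) X (delta_mx ij.1 ij.2)) <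
    e / N.+1%:R.
  by apply: (filter_forall (F := nbhs X)) => -[i j]; exact: dlim.
apply: (@filterS2 _ (nbhs X) (nbhs_filter X) _ _ _ _
  (@near_rnorm _ (ncmx R n g) X r r0) dlimA) => Y rY dY.
rewrite (diffquot_sub r0 rP rY).
pose D (H : ncmx R n g) := diffquot (r := r) Y H - diffquot (r := r) X H.
have linD : linear D.
  move=> a H K; rewrite /D (diffquot_linear r0 rP rY) (diffquot_linear r0 rP rX).
  by rewrite scalerBr opprD addrACA.
apply: le_trans (linear_mx_bound linD (e := e / N.+1%:R) _ (Y - X)) _.
  by move=> i j; exact: ltW (dY (i, j)).
apply: ler_wpM2r; first exact: rnorm_ge0.
by rewrite mulrCA ger_pMr // ler_pdivrMr // mul1r ler_nat.
Qed.

End Derivative.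

(** A positive [e] in the little-o condition over [R[i]] is real, so the real estimate supplies
    it. *)
Lemma differentiable_of_estimate {R : realType} {m n p q : nat}
    (f L : 'M[R[i]]_(m, n) -> 'M[R[i]]_(p, q)) (X : 'M[R[i]]_(m, n)) :
  linear L ->
  (forall e : R, 0 < e ->
    \forall Y \near X, rnorm (f Y - f X - L (Y - X)) <= e * rnorm (Y - X)) ->
  differentiable f X.
Proof.
move=> lin est; pose LL := GRing.isLinear.Build R[i] _ 'M[R[i]]_(p, q) *:%R L lin.
pose phi : {linear 'M[R[i]]_(m, n) -> 'M[R[i]]_(p, q)} := HB.pack L LL.
have cphi : continuous phi by exact: mx_linear_continuous.
have fE : f \o shift X = cst (f X) + phi +o_ (0 : 'M[R[i]]_(m, n)) id.
  apply/eqaddoP => e e0.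
  have eE : (complex.Re e)%:C%C = e by apply: RRe_real; exact: gtr0_real.
  have Re0 : 0 < complex.Re e by rewrite -ltcR eE.
  have cX : h + X @[h --> (0 : 'M[R[i]]_(m, n))] --> 0 + X.
    have h := (@cvgD R[i] 'M[R[i]]_(m, n) _ _ (nbhs_filter (0 : 'M[R[i]]_(m, n))) id (cst X) 0 X).
    by apply: h; [exact: cvg_id|exact: cvg_cst].
  rewrite add0r in cX.
  apply: (@filterS _ (nbhs (0 : 'M[R[i]]_(m, n))) (nbhs_filter _) _ _ _ (cX _ (est _ Re0))) => h.
  rewrite /= addrK -lecR rmorphM /= !rnormE eE.
  by rewrite !fctE /= opprD addrA.
apply/diff_locallyP; rewrite (diff_unique cphi fE); split=> //.
Qed.

Lemma linear_inj_surj {K : fieldType} {m n : nat} (L : 'M[K]_(m, n) -> 'M[K]_(m, n)) :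
  linear L -> (forall H, L H = 0 -> H = 0) -> forall W, exists H, L H = W.
Proof.
move=> lin inj W; pose LL := GRing.isLinear.Build K _ 'M[K]_(m, n) *:%R L lin.
pose phi : {linear 'M[K]_(m, n) -> 'M[K]_(m, n)} := HB.pack L LL.
have Au : lin_mx phi \in unitmx.
  rewrite -row_free_unit; apply: inj_row_free => v.
  rewrite -[v]vec_mxK mul_vec_lin => /(congr1 vec_mx); rewrite mxvecK linear0 => /inj ->.
  by rewrite linear0.
exists (vec_mx (mxvec W *m invmx (lin_mx phi))).
apply: (can_inj (@mxvecK _ _ _)); rewrite -[L]/(phi : _ -> _) -mul_vec_lin vec_mxK.
by rewrite mulmxKV.
Qed.

(** * Surjectivity and the inverse for proper continuous free maps *)

Section ProperContinuous.
Context {R : realType} {g : nat} {U V : forall n, set (ncmx R n g)}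
  {f : forall n, ncmx R n g -> ncmx R n g}.
Local Notation C := R[i].
Hypothesis domU : nc_domain U.
Hypothesis domV : nc_domain V.
Hypothesis free : free_map U f.
Hypothesis fUV : maps_into U V f.
Hypothesis fp : proper_map U V f.
Hypothesis fc : continuous_map U f.

Lemma proper_free_one_to_one : one_to_one U f.
Proof. by apply: free_one_to_one; exact: (proper_intertwines_inv domU free domV.1 fUV fp). Qed.

(** Take [v] with [L v = W - f X] and move to [X + s v]. To first order [f Y - W] is
    [(1 - s)(f X - W)], a gain of [s d] that outweighs an error of at most [s d / 2]. *)
Lemma free_decrease {n : nat} (X W : ncmx R n g) (A : set (ncmx R n g)) :
  (0 < n)%N -> U X -> f X <> W -> nbhs X A ->
  exists2 Y, A Y & rnorm (f Y - W) < rnorm (f X - W).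
Proof.
move=> n0 UX fXW nA.
have [L lin [est /(_ proper_free_one_to_one) inj]] := free_derivative domU free n0 UX fc.
have [v Lv] := linear_inj_surj lin inj (W - f X).
set d := rnorm (f X - W).
have d0 : 0 < d.
  rewrite lt_neqAle rnorm_ge0 andbT eq_sym; apply/eqP => /rnorm_eq0 /eqP.
  by rewrite subr_eq0 => /eqP.
have v0 : 0 < 1 + rnorm v by rewrite ltr_pwDl // rnorm_ge0.
(* This tolerance times [rnorm v] is at most [d / 2]. *)
have e0 : 0 < d / (2 * (1 + rnorm v)) by rewrite divr_gt0 // mulr_gt0.
have [r r0 rA] := rnorm_nbhs (@filterI _ (nbhs X) (nbhs_filter X) _ _ nA (est _ e0)).
(* The bound 1 keeps [1 - s] nonnegative; the other keeps [Y] within [r] of [X]. *)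
pose s := Num.min 1 (admissible_scale (r := r) v).
have s0 : 0 < s by rewrite lt_min ltr01 admissible_scale_gt0.
have s1 : s <= 1 by rewrite ge_min lexx.
have sv : rnorm (s%:C%C *: v) < r by apply: admissible_scaleP => //; rewrite ge_min lexx orbT.
pose Y := s%:C%C *: v + X.
have YX : Y - X = s%:C%C *: v by rewrite addrK.
have [AY] := rA Y (ltac:(rewrite YX; exact: sv)).
rewrite YX => estY; exists Y => //.
have L0 : L 0 = 0 by have := lin (-1) 0 0; rewrite scaler0 addr0 scaleN1r addNr.
have LsE : L (s%:C%C *: v) = s%:C%C *: (W - f X).
  by rewrite -[s%:C%C *: v]addr0 lin Lv L0 addr0.
have -> : f Y - W = (f Y - f X - s%:C%C *: (W - f X)) + (1 - s)%:C%C *: (f X - W).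
  rewrite rmorphB /= scalerBl scale1r -[W - f X]opprB scalerN opprK.
  by rewrite -addrA [_ *: _ + _]addrC subrK addrA subrK.
apply: le_lt_trans (rnormD _ _) _; rewrite rnormZ -/d ger0_norm ?subr_ge0 //.
rewrite LsE rnormZ gtr0_norm // in estY.
have ev : d / (2 * (1 + rnorm v)) * rnorm v <= d / 2.
  have : d / (2 * (1 + rnorm v)) * (2 * (1 + rnorm v)) = d.
    by rewrite divfK // mulf_neq0 // gt_eqF.
  by move: (d / _) e0 => x x0; lra.
have sev : s * (d / (2 * (1 + rnorm v)) * rnorm v) <= s * (d / 2) by rewrite ler_pM2l.
have sd0 : 0 < s * d by rewrite mulr_gt0.
by lra.
Qed.

(** For each [Z'] near [Z], minimise the distance from [f Y] to [Z'] over the compact preimage [K]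
    of a ball around [Z]. The minimiser is interior to [K], so [free_decrease] forces the minimum to
    be 0. *)
Lemma closure_image_interior {n : nat} (Z : ncmx R n g) : (0 < n)%N -> V Z ->
  closure (image_nc U f (n := n)) Z -> nbhs Z (image_nc U f (n := n)).
Proof.
move=> n0 VZ clZ; have oV := (domV.2 n n0).1.
have [r r0 rV] := rnorm_nbhs (open_nbhs_nbhs (conj oV VZ)).
pose B : set (ncmx R n g) := [set W | rnorm (W - Z) <= r / 2].
have BV : B `<=` V (n := n) by move=> W BW; apply: rV; apply: le_lt_trans BW _; lra.
have cL := fp n0 BV (@compact_rball R _ _ Z (r / 2)).
set K := (X in compact X) in cL.
(* [f Y1] and [Z'] lie within [r / 8] of [Z], so the minimum is below [r / 4] and [f c] is within
   [3 r / 8] of [Z]. A margin of [r / 8] then remains inside [B]. *)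
have r8 : 0 < r / 8 by lra.
have [_ [[Y1 UY1 <-] nY1]] := clZ _ (@near_rnorm _ (ncmx R n g) Z _ r8).
apply: (@filterS _ (nbhs Z) (nbhs_filter Z) _ _ _ (@near_rnorm _ (ncmx R n g) Z _ r8)) => Z' nZ'.
have near3 (A : ncmx R n g) : rnorm (A - Z) <= rnorm (A - Z') + r / 8.
  apply: le_trans (_ : _ <= rnorm (A - Z') + rnorm (Z' - Z)) _; last by rewrite lerD2l ltW.
  by have := rnormD (A - Z') (Z' - Z); rewrite addrA subrK.
have KY1 : K Y1 by split => //=; rewrite /B /= in nY1 *; lra.
have cK : {within K, continuous (fun Y => rnorm (f Y - Z'))}.
  apply: continuous_in_subspaceT => Y /set_mem [UY _].
  apply: (@continuous_comp _ _ _ (f (n := n)) (fun W => rnorm (W - Z'))); first exact: fc.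
  exact: rdist_continuous.
have [c /set_mem [Uc Bc] cmin] := compact_EVT_min (ex_intro _ Y1 KY1) cL cK.
have [<-|fcZ] := pselect (f c = Z'); first by exists c.
have cY1 : rnorm (f c - Z') < r / 4.
  apply: le_lt_trans (cmin _ (mem_set KY1)) _.
  have := rnormD (f Y1 - Z) (Z - Z'); rewrite addrA subrK -(rnormN (Z - Z')) opprB.
  by move: nY1 nZ' => /=; lra.
have nB : nbhs (f c) B.
  apply: (@filterS _ (nbhs (f c)) (nbhs_filter (f c)) _ _ _
    (@near_rnorm _ (ncmx R n g) (f c) _ r8)) => W nW.
  have := rnormD (W - f c) (f c - Z); rewrite addrA subrK => h.
  by have := near3 (f c); rewrite /B /=; lra.
have nK : nbhs c K.
  apply: (@filterI _ (nbhs c) (nbhs_filter c)); last exact: (fc n0 Uc nB).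
  exact: (open_nbhs_nbhs (conj (domU.2 n n0).1 Uc)).
have [Y KY] := free_decrease n0 Uc fcZ nK.
by have := cmin _ (mem_set KY); lra.
Qed.

(** The image contains [f 0] and is open and relatively closed in the connected set [V n]. *)
Lemma proper_free_surj {n : nat} (Z : ncmx R n g) : (0 < n)%N -> contains0 U ->
  V Z -> image_nc U f Z.
Proof.
move=> n0 U0 VZ; have [oV cV] := domV.2 n n0.
have SV : image_nc U f (n := n) `<=` V (n := n) by move=> _ [X UX <-]; exact: fUV.
suff -> : image_nc U f (n := n) = V (n := n) by [].
apply: cV.
- by exists (f 0), 0 => //; exact: U0.
- exists (image_nc U f (n := n)); last by rewrite setIidr.
  rewrite openE => W SW; apply: closure_image_interior => //; first exact: SV.
  exact: subset_closure.
- exists (closure (image_nc U f (n := n))); first exact: closed_closure.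
  apply/seteqP; split=> W; first by move=> SW; split; [exact: SV|exact: subset_closure].
  by case=> VW clW; apply: nbhs_singleton; exact: closure_image_interior.
Qed.

(** Points of the compact preimage of a ball around [Z] lying outside the interior of [A] form a
    compact set. Its image is closed and misses [Z], so [h] maps points close enough to [Z] into
    [A]. *)
Lemma inverse_continuous (h : forall n, ncmx R n g -> ncmx R n g) :
  maps_into V U h ->
  (forall n, (0 < n)%N -> forall X : ncmx R n g, U X -> h n (f X) = X) ->
  (forall n, (0 < n)%N -> forall Z : ncmx R n g, V Z -> f (h n Z) = Z) ->
  continuous_map V h.
Proof.
move=> hVU hf fh n n0 Z VZ A nA; have oV := (domV.2 n n0).1.
have [r r0 rV] := rnorm_nbhs (open_nbhs_nbhs (conj oV VZ)).
pose B : set (ncmx R n g) := [set W | rnorm (W - Z) <= r / 2].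
have BV : B `<=` V (n := n) by move=> W BW; apply: rV; apply: le_lt_trans BW _; lra.
have cL := fp n0 BV (@compact_rball R _ _ Z (r / 2)).
have cK := compact_closedI cL (open_closedC (@open_interior _ A)).
set K := (X in compact X) in cK.
have cfK : compact (f (n := n) @` K).
  apply: continuous_compact cK; apply: continuous_in_subspaceT => Y /set_mem [[UY _] _].
  exact: fc.
have oK : open (~` (f (n := n) @` K)).
  by apply: closed_openC; apply: compact_closed cfK; exact: norm_hausdorff.
have nZK : (~` (f (n := n) @` K)) Z.
  move=> [Y [[UY _] AY] fY]; apply: AY; rewrite -(hf n n0 Y UY) fY.
  exact: nA.
have r2 : 0 < r / 2 by lra.
apply: (@filterS2 _ (nbhs Z) (nbhs_filter Z) _ _ _ _
  (@near_rnorm _ (ncmx R n g) Z _ r2) (open_nbhs_nbhs (conj oK nZK))) => W nW KW.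
have BW : B W by exact: ltW.
apply: contrapT => AhW; apply: KW; exists (h n W); last by rewrite fh //; exact: BV.
split; last by move=> /interior_subset.
by split; [apply: hVU => //; exact: BV|rewrite /= fh //; exact: BV].
Qed.

(** The preimage of [K] under [h] is the continuous image [f K]. *)
Lemma inverse_proper (h : forall n, ncmx R n g -> ncmx R n g) :
  maps_into V U h ->
  (forall n, (0 < n)%N -> forall X : ncmx R n g, U X -> h n (f X) = X) ->
  (forall n, (0 < n)%N -> forall Z : ncmx R n g, V Z -> f (h n Z) = Z) ->
  proper_map V U h.
Proof.
move=> hVU hf fh n n0 K KU cK.
suff -> : V (n := n) `&` h n @^-1` K = f (n := n) @` K.
  apply: continuous_compact cK; apply: continuous_in_subspaceT => Y /set_mem /KU UY.
  exact: fc.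
apply/seteqP; split=> [Z [VZ KZ]|_ [X KX <-]]; first by exists (h n Z) => //; exact: fh.
by split; [apply: fUV => //; exact: KU|rewrite /= hf //; exact: KU].
Qed.

End ProperContinuous.

Lemma free_analytic {R : realType} {g gt : nat} {U : forall n, set (ncmx R n g)}
    {f : forall n, ncmx R n g -> ncmx R n gt} :
  nc_domain U -> free_map U f -> continuous_map U f -> analytic_map U f.
Proof.
move=> domU free fc n n0 X UX.
have [L lin [est _]] := free_derivative domU free n0 UX fc.
exact: differentiable_of_estimate lin est.
Qed.

Theorem theorem3p1 (R : realType) (g gt : nat) (Hg : (0 < g)%N) (Hgt : (0 < gt)%N)
  (U : forall n, set (ncmx R n g)) (V : forall n, set (ncmx R n gt))
  (f : forall n, ncmx R n g -> ncmx R n gt) :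
  nc_domain U -> contains0 U -> nc_domain V -> contains0 V ->
  maps_into U V f -> free_map U f ->
  (* (1) *)
  (proper_map U V f ->
     one_to_one U f /\
     nc_set (image_nc U f) /\
     exists h : forall n, ncmx R n gt -> ncmx R n g,
       (forall n, (0 < n)%N -> forall X, U n X -> h n (f n X) = X) /\
       free_map (image_nc U f) h) /\
  (* (2) *)
  ((forall n, (0 < n)%N -> forall Z : ncmx R n gt,
      compact (closure (U n `&` f n @^-1` [set Z])) /\
      closure (U n `&` f n @^-1` [set Z]) `<=` U n) ->
     one_to_one U f /\
     nc_set (image_nc U f) /\
     exists h : forall n, ncmx R n gt -> ncmx R n g,
       (forall n, (0 < n)%N -> forall X, U n X -> h n (f n X) = X) /\
       free_map (image_nc U f) h) /\
  (* (3) *)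
  (g = gt -> proper_map U V f -> continuous_map U f ->
     one_to_one U f /\
     (forall n, (0 < n)%N -> forall Z, V n Z -> exists2 X, U n X & f n X = Z) /\
     exists h : forall n, ncmx R n gt -> ncmx R n g,
       maps_into V U h /\
       (forall n, (0 < n)%N -> forall X, U n X -> h n (f n X) = X) /\
       (forall n, (0 < n)%N -> forall Z, V n Z -> f n (h n Z) = Z) /\
       free_map U f /\ proper_map U V f /\ analytic_map U f /\
       free_map V h /\ proper_map V U h /\ analytic_map V h).
Proof.
move=> domU U0 domV V0 fUV free; split; [|split].
- move=> fp; apply: (free_map_inverse domU.1 free).
  exact: (proper_intertwines_inv domU free domV.1 fUV fp).
- move=> fib; apply: (free_map_inverse domU.1 free).
  exact: (compact_fiber_intertwines_inv domU free fib).
move=> ggt; subst gt => fp fc.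
have inv := proper_intertwines_inv domU free domV.1 fUV fp.
have surj n Z : (0 < n)%N -> V n Z -> image_nc U f Z.
  by move=> n0 VZ; exact: (proper_free_surj domU domV free fUV fp fc).
split; first exact: (free_one_to_one inv).
split; first by move=> n n0 Z VZ; have [X UX fX] := surj n Z n0 VZ; exists X.
have hVU : maps_into V U (inverse_map U f).
  by move=> n n0 Z VZ; have [] := inverse_mapK n0 (surj n Z n0 VZ).
have fh n : (0 < n)%N -> forall Z, V n Z -> f n (inverse_map U f Z) = Z.
  by move=> n0 Z VZ; have [] := inverse_mapK n0 (surj n Z n0 VZ).
have hf := inverse_map_left inv.
(* By surjectivity, freeness on the image is freeness on [V]. *)
have hfree : free_map V (inverse_map U f).
  move=> n m Z W G n0 m0 VZ VW.
  by apply: (inverse_map_free inv) => //; exact: surj.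
exists (inverse_map U f); split; first exact: hVU.
split; first exact: hf.
split; first exact: fh.
split; first exact: free.
split; first exact: fp.
split; first exact: free_analytic.
split; first exact: hfree.
split; first exact: (inverse_proper fUV fc hVU hf fh).
(* The inverse is itself a continuous free map, on the domain [V]. *)
apply: (free_analytic domV hfree); exact: (inverse_continuous domV fp fc hVU hf fh).
Qed.
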